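(* Let $\mathbb{F}$ be an infinite field and let $A$ be an $\mathbb{F}$-algebra with $\dim_{\mathbb{F}} A < \infty$. Let $M = \bigoplus_{i \in I} A m_i$ be any direct sum of cyclic $A$-modules (indexed by a set $I$), and let $J$ be a set. Then $M$ is a union of ''$J$-many'' proper $A$-submodules (that is, there is a family $(M_j)_{j \in J}$ of proper $A$-submodules of $M$ with $M = \bigcup_{j\in J} M_j$) if and only if $M$ is not cyclic and $J \geq \nu(\mathbb{F}, M, 1)$.
   Context: Algebras are associative and unital, and modules are unital left modules. A module is cyclic if it is generated by one element. Sets are compared by cardinality: for sets $I, J$, write $J > I$ if there is no one-to-one map $J \to I$; otherwise write $J \leq I$ (equivalently $I \geq J$). ''$J$-many'' submodules means a family of submodules indexed by the set $J$; the members need not be distinct. For a vector space $V$ over a field $\mathbb{F}$ and a natural number $k$ with $1 \le k < \dim_{\mathbb{F}} V$, the quantity $\nu(\mathbb{F},V,k)$ is defined by \[ \nu(\mathbb{F},V,k) := \begin{cases} \left\lceil |\mathbb{P}(V)| / |\mathbb{P}(V/\mathbb{F}^k)| \right\rceil, & \text{if } |V| < \infty;\\ \mathbb{N}, & \text{if } \mathbb{F} \text{ and } \dim_{\mathbb{F}} V \text{ are both infinite};\\ \mathbb{F}^k \coprod \{\infty\}, & \text{otherwise,} \end{cases} \] where $\mathbb{P}(W)$ is the set of lines (one-dimensional subspaces) of $W$ and $V/\mathbb{F}^k$ is the quotient of $V$ by a $k$-dimensional subspace. Here it is applied with $k=1$ and $V = M$ regarded as an $\mathbb{F}$-vector space (a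 non-cyclic $M$ always satisfies $\dim_{\mathbb{F}} M > 1$); since $\mathbb{F}$ is infinite, $\nu(\mathbb{F},M,1)$ is $\mathbb{N}$ if $\dim_{\mathbb{F}} M$ is infinite, and $\mathbb{F}\coprod\{\infty\}$ if $\dim_{\mathbb{F}} M$ is finite. *)

(* Defs.v *)
From HB Require Import structures.
From mathcomp Require Import all_boot all_order all_algebra all_field.
From mathcomp Require Import finmap.
From mathcomp Require Import boolp classical_sets functions cardinality.

Set Implicit Arguments.
Unset Strict Implicit.
Unset Printing Implicit Defensive.

Import GRing.Theory.

Local Open Scope classical_set_scope.
Local Open Scope ring_scope.

(* An F-algebra acts through the scalars c%:A: restriction makes every
   A-module an F-vector space with the same underlying additive group. *)
Definition restr_scalars (F : fieldType) (A : falgType F) (M : lmodType A) : Type := M.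

Section Restrict.
Context (F : fieldType) (A : falgType F) (M : lmodType A).
Implicit Types (c d : F) (x y : M).

Let rscale c x : M := c%:A *: x.

Let rscaleA c d x : rscale c (rscale d x) = rscale (c * d) x.
Proof. by rewrite /rscale scalerA -scalerAl mul1r scalerA. Qed.

Let rscale1 : left_id 1 rscale.
Proof. by move=> x; rewrite /rscale !scale1r. Qed.

Let rscaleDr : right_distributive rscale +%R.
Proof. by move=> c x y; rewrite /rscale scalerDr. Qed.

Let rscaleDl x : {morph rscale^~ x : c d / c + d}.
Proof. by move=> c d; rewrite /rscale !scalerDl. Qed.

HB.instance Definition _ := GRing.Zmodule.on (@restr_scalars F A M).
HB.instance Definition _ := GRing.Zmodule_isLmodule.Build F
  (@restr_scalars F A M) rscaleA rscale1 rscaleDr rscaleDl.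

End Restrict.

Section Modules.
Context (A : pzRingType) (M : lmodType A).

Definition cyclic_module : Prop := exists m : M, forall x, exists a : A, x = a *: m.

Definition submodule (N : set M) : Prop := submod_closed [in N].

Definition proper_submodule (N : set M) : Prop := submodule N /\ N <> [set: M].

(* M is the internal direct sum of the submodules A m_i, for an arbitrary index
   type I.  Finite subfamilies are given by maps 'I_n -> I.  Independence says
   that the components a_i m_i vanish, not the coefficients a_i: the A m_i need
   not be free. *)
Definition direct_sum_cyclic (I : Type) (m : I -> M) : Prop :=
  (forall x : M, exists (n : nat) (i : 'I_n -> I) (a : 'I_n -> A),
      x = \sum_(k < n) a k *: m (i k)) /\
  (forall (n : nat) (i : 'I_n -> I) (a : 'I_n -> A), injective i ->
      \sum_(k < n) a k *: m (i k) = 0 -> forall k, a k *: m (i k) = 0).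

End Modules.
Arguments cyclic_module {A} M.

Section Nu.
Context (F : fieldType) (V : lmodType F).

Definition finite_dim : Prop :=
  exists (n : nat) (f : {linear 'rV[F]_n -> V}), bijective f.

Definition subspace_of_dim (k : nat) (U : set V) : Prop :=
  exists2 f : {linear 'rV[F]_k -> V}, injective f & U = range f.

Definition lines : set (set V) :=
  [set L | exists2 v : V, v != 0 & L = [set a *: v | a in [set: F]]].

(* The vectors of V / U are the cosets v + U. *)
Definition quotient_vector (U : set V) (v : V) : set V := [set v + u | u in U].

Definition quotient_lines (U : set V) : set (set (set V)) :=
  [set L | exists2 v : V, ~ U v &
     L = [set quotient_vector U (a *: v) | a in [set: F]]].

(* A finite value n is represented by 'I_n, and F^k together with a point at
   infinity by option.  In the finite case the copy of F^k inside V is a chosen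
   k-dimensional subspace; the number of lines of the quotient does not depend
   on the choice. *)
Definition nu (k : nat) : Type :=
  if pselect (finite_set [set: V]) then
    let U := xget set0 (subspace_of_dim k) in
    let q : rat :=
      #|` fset_set lines|%:R / #|` fset_set (quotient_lines U)|%:R in
    ('I_`|Num.ceil q|%N : Type)
  else if pselect (infinite_set [set: F] /\ ~ finite_dim) then (nat : Type)
  else option 'rV[F]_k.

End Nu.
Arguments finite_dim {F} V.
Arguments lines {F} V.
Arguments nu {F} V k.

(* Main.v *)
Require Import Defs.
From HB Require Import structures.
From mathcomp Require Import all_boot all_order all_algebra all_field.
From mathcomp Require Import finmap.
From mathcomp Require Import boolp classical_sets functions cardinality.

Set Implicit Arguments.
Unset Strict Implicit.
Unset Printing Implicit Defensive.

Import GRing.Theory.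

Local Open Scope classical_set_scope.
Local Open Scope card_scope.
Local Open Scope ring_scope.

(** A module covered by proper submodules is not cyclic, since the member that
    contains a generator would be everything; what remains is to count the
    members of a cover.

    Lower bound on the number of members.  Given vectors x_0, ..., x_(n-1), the
    moment curve c(t) = \sum_k t^k x_k lies in a subspace that misses some x_k for
    fewer than n values of t: from n points of the curve with distinct parameters
    the x_k are recovered by inverting a Vandermonde matrix
    ([moment_curve_inv]).  Sending t to a member that contains c(t) is thus
    a map from F to J with finite fibers, as soon as no member contains all the
    x_k.  If J were finite, one vector missed by each member would give such
    x_k, and F would be finite ([cover_infinite]).  If M has finite dimension,
    a basis serves as the x_k, and a map with finite fibers from an infinite
    set forces |F| <= |J| ([cover_finite_dim]).

    Covers with few members.  If M is not cyclic, it is the union of its proper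
    submodules A x; in finite dimension there are at most |M| = |F^n| = |F| of
    them.  If M has infinite dimension, infinitely many m_i are nonzero, because
    A has finite dimension; with i_0, i_1, ... the indices of infinitely many of
    them, the submodules spanned by the m_i with i not in {i_p, i_(p+1), ...}
    form a countable cover, and the p-th one misses m_(i_p) because the sum is
    direct ([infinite_dim_cover]).

    Both counts rest on Hessenberg's theorem |T * T| = |T| for infinite T
    ([card_le_square]): it gives |F^n| <= |F|, and also that J * nat is no larger
    than an infinite J, which is what bounds the source of a map with finite
    fibers.  By it, F together with a point at infinity has the size of F. *)

(** * Comparing cardinalities *)

Lemma card_le_inj T U (A : set T) (B : set U) (f : T -> U) :
  (forall x, A x -> B (f x)) ->
  (forall x y, A x -> A y -> f x = f y -> x = y) -> A #<= B.
Proof.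
move=> fAB finj.
have : f @` A #= A.
  by apply: inj_card_eq => x y /set_mem Ax /set_mem Ay; apply: finj.
rewrite card_eq_le => /andP[_ AfA].
apply: card_le_trans AfA _; apply: subset_card_le => _ [x Ax <-]; exact: fAB.
Qed.

Lemma card_le_injE T U (u0 : U) (A : set T) (B : set U) : A #<= B ->
  exists2 f : T -> U, (forall x, A x -> B (f x)) &
    (forall x y, A x -> A y -> f x = f y -> x = y).
Proof.
elim/Ppointed: U => U in u0 B *; first by case: (no u0).
move=> /pcard_leP/injfunPex[f fAB finj]; exists f => // x y Ax Ay.
by apply: finj; exact: mem_set.
Qed.

Lemma card_le_rel T U (A : set T) (B : set U) (R : T -> U -> Prop) :
  (forall x, A x -> exists2 y, B y & R x y) ->
  (forall x x' y, R x y -> R x' y -> x = x') -> A #<= B.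
Proof.
elim/Ppointed: U => U in B R *.
  move=> AR _; suff -> : A = set0 by exact: card_ge0.
  by apply/seteqP; split => // x /AR[y]; case: (no y).
move=> AR Rinj.
have AR' x : exists y, A x -> B y /\ R x y.
  by have [/AR[y By Rxy]|nA] := pselect (A x); [exists y|exists point].
have [f fP] := choice AR'.
apply: (@card_le_inj _ _ _ _ f) => [x /fP[]//|x y /fP[_ Rx] /fP[_ Ry] e].
by apply: (Rinj _ _ (f x)) => //; rewrite e.
Qed.

Lemma total_on_common T (F : set (set T)) p q : total_on F subset ->
  (\bigcup_(X in F) X) p -> (\bigcup_(X in F) X) q ->
  exists2 X, F X & X p /\ X q.
Proof.
move=> totF [X FX Xp] [Y FY Yq].
have [XY|YX] := totF _ _ FX FY; [exists Y|exists X] => //; split=> //.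
- exact: XY.
- exact: YX.
Qed.

(** Any two sets are comparable: a maximal partial injection between them, which
    exists by Zorn's lemma, exhausts one side, for otherwise a pair of leftover
    points could be added. *)
Lemma card_le_total T U (A : set T) (B : set U) : A #<= B \/ B #<= A.
Proof.
pose P (G : set (T * U)) := [/\ (forall p, G p -> A p.1 /\ B p.2),
  (forall x y y', G (x, y) -> G (x, y') -> y = y') &
  (forall x x' y, G (x, y) -> G (x', y) -> x = x')].
have [F FP totF|G [[GAB Gfun Ginj] Gmax]] := @Zorn_bigcup _ P.
  have common p q := @total_on_common _ F p q totF.
  split=> [p [X /FP[+ _ _]]|x y y' p q|x x' y p q]; first exact.
    by have [X /FP[_ + _] [? ?]] := common _ _ p q; apply; eassumption.
  by have [X /FP[_ _ +] [? ?]] := common _ _ p q; apply; eassumption.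
have [AG|/existsNP[a /not_implyP[Aa Ga]]] :=
  pselect (forall x, A x -> exists y, G (x, y)).
  left; apply: (@card_le_rel _ _ _ _ (fun x y => G (x, y))) => // x /AG[y Gxy].
  by exists y => //; case: (GAB _ Gxy).
have [BG|/existsNP[b /not_implyP[Bb Gb]]] :=
  pselect (forall y, B y -> exists x, G (x, y)).
  right; apply: (@card_le_rel _ _ _ _ (fun y x => G (x, y))).
    by move=> y /BG[x Gxy]; exists x => //; case: (GAB _ Gxy).
  by move=> y y' x; exact: Gfun.
exfalso; apply: (Gmax (G `|` [set (a, b)])).
  split; first by move=> p; left.
  by move=> /(_ (a, b) (or_intror erefl)) Gab; apply: Ga; exists b.
split=> [p [/GAB//|-> //]|x y y'|x x' y].
- move=> [Gxy|[ex ey]] [Gxy'|[ex' ey']]; first exact: Gfun Gxy Gxy'.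
  + by case: Ga; exists y; rewrite -ex'.
  + by case: Ga; exists y'; rewrite -ex.
  + by rewrite ey ey'.
- move=> [Gxy|[ex ey]] [Gxy'|[ex' ey']]; first exact: Ginj Gxy Gxy'.
  + by case: Gb; exists x; rewrite -ey'.
  + by case: Gb; exists x'; rewrite -ey.
  + by rewrite ex ex'.
Qed.

(** * The square of an infinite set *)

Section Hessenberg.
Variable T : pointedType.

(** A pairing of a set X is an injection of X * X into X.  Its graph determines
    X through the diagonal, so that Zorn's lemma for inclusion applies to graphs
    without recording X separately. *)
Definition square_dom (G : set (T * T * T)) : set T :=
  [set x | exists z, G (x, x, z)].

Record pairing_graph (G : set (T * T * T)) : Prop := PairingGraph {
  pairing_fun : forall x y z z', G (x, y, z) -> G (x, y, z') -> z = z';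
  pairing_inj : forall x y x' y' z, G (x, y, z) -> G (x', y', z) -> x = x' /\ y = y';
  pairing_sub : forall x y z, G (x, y, z) ->
    [/\ square_dom G x, square_dom G y & square_dom G z];
  pairing_total : forall x y, square_dom G x -> square_dom G y ->
    exists z, G (x, y, z)
}.

Lemma pairing_graph_bigcup (F : set (set (T * T * T))) :
  F `<=` pairing_graph -> total_on F subset ->
  pairing_graph (\bigcup_(X in F) X).
Proof.
move=> FP totF.
have common p q := @total_on_common _ F p q totF.
have domU X x : F X -> square_dom X x -> square_dom (\bigcup_(X in F) X) x.
  by move=> FX [z Xz]; exists z; exists X.
split=> [x y z z' p q|x y x' y' z p q|x y z [X FX Xp]|x y [z p] [z' q]].
- have [X /FP PX [? ?]] := common _ _ p q; apply: (pairing_fun PX); eassumption.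
- have [X /FP PX [? ?]] := common _ _ p q; apply: (pairing_inj PX); eassumption.
- have [? ? ?] := pairing_sub (FP _ FX) Xp.
  by split; apply: (domU X).
- have [X FX [Xp Xq]] := common _ _ p q.
  have [t Xt] := pairing_total (FP _ FX) (ex_intro _ _ Xp) (ex_intro _ _ Xq).
  by exists t; exists X.
Qed.

Definition fun_graph (X : set T) (f : T -> T -> T) : set (T * T * T) :=
  [set p | [/\ X p.1.1, X p.1.2 & p.2 = f p.1.1 p.1.2]].

Definition pairing_on (X : set T) (f : T -> T -> T) : Prop :=
  (forall x y, X x -> X y -> X (f x y)) /\
  (forall x y x' y', X x -> X y -> X x' -> X y' -> f x y = f x' y' ->
    x = x' /\ y = y').

Lemma square_dom_fun_graph X f : square_dom (fun_graph X f) = X.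
Proof. by apply/seteqP; split=> [x [z []]//|x Xx]; exists (f x x). Qed.

Lemma pairing_fun_graph X f : pairing_on X f -> pairing_graph (fun_graph X f).
Proof.
move=> [fX finj]; split; rewrite ?square_dom_fun_graph.
- by move=> x y z z' [/= _ _ ->] [/= _ _ ->].
- by move=> x y x' y' z [/= Xx Xy ->] [/= Xx' Xy' /finj]; apply.
- by move=> x y z [/= Xx Xy ->]; split => //; exact: fX.
- by move=> x y Xx Xy; exists (f x y).
Qed.

Lemma pairing_graphE G : pairing_graph G ->
  exists2 f, pairing_on (square_dom G) f & G = fun_graph (square_dom G) f.
Proof.
move=> PG.
have tot p : exists z, square_dom G p.1 -> square_dom G p.2 -> G (p, z).
  have [[/= D1 D2]|nD] := pselect (square_dom G p.1 /\ square_dom G p.2).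
    have [z Gz] := pairing_total PG D1 D2; exists z.
    by rewrite -surjective_pairing in Gz.
  by exists point => D1 D2; case: nD.
have [f fP] := choice tot.
have fG x y (Dx : square_dom G x) (Dy : square_dom G y) : G (x, y, f (x, y)).
  exact: (fP (x, y)).
exists (fun x y => f (x, y)).
  split=> [x y Dx Dy|x y x' y' Dx Dy Dx' Dy' e].
    by case: (pairing_sub PG (fG _ _ Dx Dy)).
  by apply: (pairing_inj PG (fG _ _ Dx Dy)); rewrite e; exact: fG.
apply/seteqP; split=> [[[x y] z] Gp|[[x y] z] [/= Dx Dy ->]]; last exact: fG.
have [Dx Dy _] := pairing_sub PG Gp; split => //=.
exact: (pairing_fun PG) Gp (fG _ _ Dx Dy).
Qed.

(** If X has a pairing f and h embeds X in its complement, then f extends to the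
    union of X and its copy h(X).  Points of the union are coded as (b, x) with
    b telling the copy; the pairs of codes (b, x), (c, y) with b or c true are
    sent into h(X) by using f twice, the tag t(b, c) recording the flags. *)
Lemma pairing_on_extend (X : set T) f (t : bool -> bool -> T) (h : T -> T) :
  pairing_on X f ->
  (forall b c, X (t b c)) ->
  (forall b c b' c', t b c = t b' c' -> b = b' /\ c = c') ->
  (forall x, X x -> ~ X (h x)) ->
  (forall x y, X x -> X y -> h x = h y -> x = y) ->
  exists2 g, pairing_on (X `|` h @` X) g & forall x y, X x -> X y -> g x y = f x y.
Proof.
move=> [fX finj] tX tinj hX hinj.
pose e (b : bool) x := if b then h x else x.
have edec u : exists p : bool * T, (X `|` h @` X) u -> X p.2 /\ u = e p.1 p.2.
  have [[Xu|[x Xx <-]]|nu] := pselect ((X `|` h @` X) u).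
  - by exists (false, u).
  - by exists (true, x).
  - by exists (false, u) => /nu.
have [d dP] := choice edec.
have dX u : (X `|` h @` X) u -> X (d u).2 by move=> /dP[].
have dE u : (X `|` h @` X) u -> e (d u).1 (d u).2 = u by move=> /dP[].
have d0 u : X u -> d u = (false, u).
  move=> Xu; have [] := dP u (or_introl Xu).
  by case: (d u) => [[] v] /= Xv euv; [case: (hX v Xv); rewrite -euv|rewrite euv].
pose k u v := f (t (d u).1 (d v).1) (f (d u).2 (d v).2).
pose g u v := if (d u).1 || (d v).1 then h (k u v) else f u v.
have kX u v : (X `|` h @` X) u -> (X `|` h @` X) v -> X (k u v).
  by move=> Xu Xv; apply: fX (tX _ _) (fX _ _ (dX _ Xu) (dX _ Xv)).
have low u : (X `|` h @` X) u -> ~~ (d u).1 -> X u.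
  by move=> Xu; move: (dX u Xu) (dE u Xu); case: (d u) => -[] //= v Xv <-.
exists g => [|x y Xx Xy]; last by rewrite /g !d0.
split=> [x y Xx Xy|x y x' y' Xx Xy Xx' Xy'].
  rewrite /g; case: ifPn => [_|]; first by right; exists (k x y) => //; exact: kX.
  by rewrite negb_or => /andP[dx dy]; left; apply: fX; apply: low.
rewrite /g; case: ifPn => [_|]; case: ifPn => [_|].
- move=> /hinj; rewrite /k => /(_ (kX _ _ Xx Xy) (kX _ _ Xx' Xy')) /finj[]//.
  + by apply: fX; apply: dX.
  + by apply: fX; apply: dX.
  + move=> /tinj[b c] /finj[||||v w]; try by apply: dX.
    by split; rewrite -[LHS]dE// -[RHS]dE// ?(b, v, c, w).
- rewrite negb_or => /andP[dx dy] E; exfalso.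
  apply: (hX (k x y)); first exact: kX.
  by rewrite E; apply: fX; apply: low.
- rewrite negb_or => /[swap] /[swap] /andP[dx dy] E; exfalso.
  apply: (hX (k x' y')); first exact: kX.
  by rewrite -E; apply: fX; apply: low.
- rewrite !negb_or => /andP[dx' dy'] /andP[dx dy].
  by apply: finj; apply: low.
Qed.

End Hessenberg.

(** Hessenberg's theorem.  Take a maximal pairing of a subset X of T.  If the
    complement of X embeds in X, then so does T = X + ~X, by tagging with two
    elements of X, and the pairing of X does the rest.  Otherwise X embeds in its
    complement and the pairing extends, against maximality. *)
Lemma card_le_square T : infinite_set [set: T] -> [set: T * T] #<= [set: T].
Proof.
elim/Ppointed: T => T.
  move=> inf; case: inf; rewrite (_ : setT = set0) //.
  by apply/seteqP; split=> // x; case: (no x).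
move=> /infiniteP/(card_le_injE point)[j _ jinj'].
have jinj a b : j a = j b -> a = b by apply: jinj'.
pose j' u : nat := xget 0%N [set a | j a = u].
have jK : @cancel T nat j j'.
  by move=> a; apply: jinj; apply: (@xgetPex _ 0%N [set b | j b = j a]); exists a.
pose f0 u v := j (choice.pickle (j' u, j' v : nat)).
have f0P : pairing_on (range j) f0.
  split=> [x y _ _|_ _ _ _ [a _ <-] [b _ <-] [c _ <-] [d _ <-]].
    by exists (choice.pickle (j' x, j' y : nat)).
  by rewrite /f0 !jK => /jinj/(pcan_inj choice.pickleK)[-> ->].
(* Only pairings that extend f0 compete for maximality, so that X contains the
   infinitely many j a, from which the tags below are taken. *)
pose G0 := fun_graph (range j) f0.
have [F FP totF|G [PG Gmax]] :=
  @Zorn_bigcup _ [set G | pairing_graph (G0 `|` G)].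
  rewrite /=.
  have -> : G0 `|` \bigcup_(X in F) X =
      \bigcup_(Y in [set G0 `|` X | X in [set set0] `|` F]) Y.
    apply/seteqP; split=> [p [G0p|[X FX Xp]]|p [_ [X [->|FX] <-]]].
    - by exists (G0 `|` set0); [exists set0 => //; left|left].
    - by exists (G0 `|` X); [exists X => //; right|right].
    - by rewrite setU0; left.
    - by case=> [G0p|Xp]; [left|right; exists X].
  apply: pairing_graph_bigcup => [_ [X [->|FX] <-]|].
  - by rewrite setU0; exact: pairing_fun_graph.
  - exact: FP.
  - move=> _ _ [X FX <-] [Y FY <-].
    suff [XY|YX] : X `<=` Y \/ Y `<=` X by [left; exact: setUS|right; exact: setUS].
    case: FX FY => [->|FX] [->|FY]; [by left|by left|by right|exact: totF].
have [f fP GE] := pairing_graphE PG.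
set X := square_dom _ in fP GE.
have jX a : X (j a).
  exists (f0 (j a) (j a)); left; split => /=; by [exists a|].
have [le_CX|le_XC] := card_le_total (~` X) X.
  have [h hX hinj] := card_le_injE point le_CX.
  pose k u := if `[< X u >] then f (j 0%N) u else f (j 1%N) (h u).
  have [fX finj] := fP.
  have kX u : X (k u).
    by rewrite /k; case: asboolP => [Xu|nXu]; apply: fX => //; exact: hX.
  have kinj u v : k u = k v -> u = v.
    rewrite /k; case: asboolP => Xu; case: asboolP => Xv /finj[] //.
    - exact: hX.
    - by move=> /jinj.
    - exact: hX.
    - by move=> /jinj.
    - exact: hX.
    - exact: hX.
    - by move=> _; apply: hinj.
  apply: (@card_le_inj _ _ _ _ (fun p => f (k p.1) (k p.2))) => //.
  by move=> [a b] [c d] _ _ /= /finj[]// /kinj -> /kinj ->.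
exfalso.
have [h hX hinj] := card_le_injE point le_XC.
have [||||g gP gf] := @pairing_on_extend _ X f
    (fun b c => j (choice.pickle (b, c : bool))) h fP.
- by move=> *; exact: jX.
- by move=> b c b' c' /jinj/(pcan_inj choice.pickleK)[-> ->].
- exact: hX.
- exact: hinj.
have GG' : G0 `|` G `<=` fun_graph (X `|` h @` X) g.
  rewrite GE => -[[x y] z] [/= Xx Xy ->]; split => /=; [by left|by left|].
  by rewrite gf.
apply: (Gmax (fun_graph (X `|` h @` X) g)).
  split; first by apply: subset_trans GG'; right.
  have hj : (X `|` h @` X) (h (j 0%N)) by right; exists (j 0%N).
  set y := h (j 0%N) in hj *.
  move=> /(_ (y, y, g y y) (And3 hj hj erefl)) Gy.
  by apply: (hX (j 0%N)) => //; exists (g y y); right; exact: Gy.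
rewrite /= (_ : G0 `|` _ = fun_graph (X `|` h @` X) g).
  exact: pairing_fun_graph.
by apply/seteqP; split=> [p [G0p|//]|p]; [apply: GG'; left|right].
Qed.

(** * Maps with finite fibers and families of sets *)

Lemma finite_fibers_infinite S J (f : S -> J) : infinite_set [set: S] ->
  (forall j, finite_set [set s | f s = j]) -> infinite_set [set: J].
Proof.
move=> infS finf finJ; apply: infS.
have -> : [set: S] = \bigcup_(j in [set: J]) [set s | f s = j].
  by apply/seteqP; split=> // s _; exists (f s).
exact: bigcup_finite.
Qed.

(** Numbering each fiber embeds S in J * nat, and J is infinite, hence no smaller
    than J * nat. *)
Lemma finite_fibers_card_le S J (f : S -> J) : infinite_set [set: S] ->
  (forall j, finite_set [set s | f s = j]) -> [set: S] #<= [set: J].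
Proof.
move=> infS finf; have infJ := finite_fibers_infinite infS finf.
have rankP j : exists r : S -> nat,
    forall s s', f s = j -> f s' = j -> r s = r s' -> s = s'.
  by have [r _ rinj] := card_le_injE 0%N (finite_set_countable (finf j)); exists r.
have [r rinj] := choice rankP.
elim/Ppointed: J => J in f finf infJ rankP r rinj *.
  have S0 : [set: S] = set0 by apply/seteqP; split=> // s _; case: (no (f s)).
  by rewrite S0; exact: card_ge0.
have [e _ einj] := card_le_injE point ((infiniteP _).1 infJ).
apply: card_le_trans (card_le_square infJ).
apply: (@card_le_inj _ _ _ _ (fun s => (f s, e (r (f s) s)))) => // s s' _ _.
by case=> ff /einj er; apply: (rinj (f s)) => //; rewrite er// ff.
Qed.

(** A cover can be reindexed along a surjection J -> K, so the members may be
    repeated to use up all of J. *)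
Lemma card_le_cover (V K J : Type) (Q : set V -> Prop) (N : K -> set V) (k0 : K) :
  [set: K] #<= [set: J] -> (forall k, Q (N k)) ->
  \bigcup_(k in [set: K]) N k = [set: V] ->
  exists N' : J -> set V, (forall j, Q (N' j)) /\
    \bigcup_(j in [set: J]) N' j = [set: V].
Proof.
move=> KJ QN NV.
have [g ginj] : exists g : K -> J, injective g.
  elim/Ppointed: J => J in KJ *.
    have : [set: K] #<= @set0 nat.
      apply: card_le_trans KJ _.
      rewrite (_ : [set: J] = set0) ?card_ge0//.
      by apply/seteqP; split => // x; case: (no x).
    by move/card_le0P => K0; have : [set: K] k0 by []; rewrite K0.
  by have [g _ ginj] := card_le_injE point KJ; exists g => x y; exact: ginj.
have hP j : exists k : K, (exists k', g k' = j) -> g k = j.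
  by have [[k gk]|n] := pselect (exists k, g k = j); [exists k|exists k0 => /n].
have [h hK] := choice hP.
exists (N \o h); split=> [j|]; first exact: QN.
apply/seteqP; split=> // v; rewrite -NV => -[k _ Nkv]; exists (g k) => //=.
by rewrite (_ : h (g k) = k)//; apply: ginj; apply: hK; exists k.
Qed.

(** * Submodules *)

Lemma submodule_scale (A : pzRingType) (M : lmodType A) (N : set M) (a : A) x :
  submodule N -> N x -> N (a *: x).
Proof.
move=> [N0 NS] Nx; have := NS a _ _ (mem_set Nx) N0; rewrite addr0.
exact: set_mem.
Qed.

Lemma submodule_sum (A : pzRingType) (V : lmodType A) (N : set V) (n : nat)
    (a : 'I_n -> A) (x : 'I_n -> V) :
  submodule N -> (forall i, N (x i)) -> N (\sum_i a i *: x i).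
Proof.
move=> Nsub Nx; elim/big_ind: _ => [|u v Nu Nv|i _].
- exact: set_mem Nsub.1.
- have := Nsub.2 1 _ _ (mem_set Nu) (mem_set Nv); rewrite scale1r; exact: set_mem.
- exact: submodule_scale.
Qed.

Lemma cyclic_submodule (A : pzRingType) (M : lmodType A) (x : M) :
  submodule [set a *: x | a in [set: A]].
Proof.
split; first by apply: mem_set; exists 0 => //; rewrite scale0r.
move=> c _ _ /set_mem[a _ <-] /set_mem[b _ <-]; apply: mem_set.
by exists (c * a + b) => //; rewrite scalerDl scalerA.
Qed.

Lemma proper_submodule_missing (A : pzRingType) (M : lmodType A) (N : set M) :
  proper_submodule N -> exists x, ~ N x.
Proof.
by move=> [_ NT]; apply/existsNP => Nall; apply: NT; apply/seteqP; split.
Qed.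

Lemma submodule_restr (F : fieldType) (A : falgType F) (M : lmodType A)
  (N : set M) : submodule N -> @submodule F (restr_scalars M) N.
Proof. by move=> [N0 NS]; split=> // c x y; exact: NS. Qed.

(** * Covering a vector space by proper subspaces *)

Section MomentCurve.
Variable F : fieldType.

(** The coefficients are a column of the inverse of the Vandermonde matrix of the
    t_j, which expresses the points of the curve through the x_k. *)
Lemma moment_curve_inv (V : lmodType F) n (x : 'I_n -> V) (t : 'I_n -> F) :
  injective t -> forall i, exists c : 'I_n -> F,
    x i = \sum_j c j *: \sum_(k < n) t j ^+ k *: x k.
Proof.
move=> tinj i; pose W := Vandermonde n (\row_j t j).
have Wu : W \in unitmx.
  rewrite unitmxE det_Vandermonde unitfE; apply/prodf_neq0 => j _.
  apply/prodf_neq0 => k jk; rewrite !mxE subr_eq0.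
  by apply: contraTneq jk => /tinj ->; rewrite ltnn.
exists (fun j => invmx W j i).
under eq_bigr do rewrite scaler_sumr.
rewrite exchange_big /= (bigD1 i) //= [X in _ = _ + X]big1 => [|k ki].
  rewrite addr0; under eq_bigr do rewrite scalerA.
  rewrite -scaler_suml (_ : \sum_j _ = (W *m invmx W) i i).
    by rewrite mulmxV// mxE eqxx scale1r.
  by rewrite mxE; apply: eq_bigr => j _; rewrite !mxE mulrC.
under eq_bigr do rewrite scalerA.
rewrite -scaler_suml (_ : \sum_j _ = (W *m invmx W) k i).
  by rewrite mulmxV// mxE (negPf ki) scale0r.
by rewrite mxE; apply: eq_bigr => j _; rewrite !mxE mulrC.
Qed.

Lemma moment_curve_finite (V : lmodType F) (N : set V) n (x : 'I_n -> V) :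
  submodule N -> ~ (forall i, N (x i)) ->
  finite_set [set t : F | N (\sum_(k < n) t ^+ k *: x k)].
Proof.
move=> Nsub; apply: contra_notP => /(infinite_set_fset n)[B BN leB] i.
have tlt (j : 'I_n) : (j < size B)%N by apply: leq_trans leB; exact: ltn_ord.
pose t (j : 'I_n) := nth 0 B j.
have tinj : injective t.
  by move=> j k /eqP; rewrite nth_uniq ?fset_uniq// => /eqP/val_inj.
have [c ->] := moment_curve_inv x tinj i.
by apply: submodule_sum => // j; apply: BN; exact: mem_nth.
Qed.

(** A cover none of whose members contains all the x_k admits a map F -> J with
    finite fibers: t goes to a member that contains the point c(t). *)
Lemma cover_moment_curve (V : lmodType F) (J : Type) (N : J -> set V) n (x : 'I_n -> V) :
  (forall j, submodule (N j)) -> (forall j, ~ forall i, N j (x i)) ->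
  \bigcup_(j in [set: J]) N j = [set: V] ->
  exists f : F -> J, forall j, finite_set [set t | f t = j].
Proof.
move=> Nsub Nx NV; pose c t := \sum_(k < n) t ^+ k *: x k.
have fP t : exists j, N j (c t).
  by have : [set: V] (c t) by []; rewrite -NV => -[j _ Nj]; exists j.
have [f fN] := choice fP; exists f => j.
apply: sub_finite_set (moment_curve_finite (Nsub j) (Nx j)) => t /= <-.
exact: fN.
Qed.

(** Were J finite, a vector missed by each of the finitely many members would
    yield a moment curve that lies in none of them entirely. *)
Lemma cover_infinite (V : lmodType F) (J : Type) (N : J -> set V) :
  infinite_set [set: F] ->
  (forall j, proper_submodule (N j)) ->
  \bigcup_(j in [set: J]) N j = [set: V] -> infinite_set [set: J].
Proof.
move=> infF Nproper NV finJ.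
have [s sE] : exists s : seq (set V), range N = [set` s].
  by apply/finite_seqP; exact: finite_image.
have xP (i : 'I_(size s)) : exists x, ~ nth set0 s i x.
  have : [set` s] (nth set0 s i) by exact: mem_nth.
  by rewrite -sE => -[j _ <-]; exact: proper_submodule_missing.
have [x xN] := choice xP.
have Nx j : ~ forall i, N j (x i).
  have js : N j \in s by have : range N (N j) by [exists j]; rewrite sE.
  have lt : (index (N j) s < size s)%N by rewrite index_mem.
  by move/(_ (Ordinal lt)); have := xN (Ordinal lt); rewrite /= nth_index.
have [f fP] := cover_moment_curve (fun j => (Nproper j).1) Nx NV.
exact: finite_fibers_infinite infF fP finJ.
Qed.

Lemma cover_finite_dim (V : lmodType F) (J : Type) (N : J -> set V) :
  infinite_set [set: F] -> finite_dim V ->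
  (forall j, proper_submodule (N j)) ->
  \bigcup_(j in [set: J]) N j = [set: V] -> [set: F] #<= [set: J].
Proof.
move=> infF [n [g [g' gK g'K]]] Nproper NV.
have [|f] := @cover_moment_curve V J N n (fun i => g (delta_mx 0 i))
  (fun j => (Nproper j).1) _ NV; last exact: finite_fibers_card_le.
move=> j Nj; case: (Nproper j) => Nsub; apply; apply/seteqP; split=> // v _.
rewrite -[v]g'K [g' v]row_sum_delta linear_sum /=.
under eq_bigr do rewrite linearZ /=.
exact: submodule_sum.
Qed.

End MomentCurve.

(** * Cardinality and dimension of vector spaces *)

Lemma infinite_lmodule (F : fieldType) (V : lmodType F) (v : V) :
  infinite_set [set: F] -> v != 0 -> infinite_set [set: V].
Proof.
move=> infF v0 finV; apply: infF; apply: card_le_finite finV.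
apply: (@card_le_inj _ _ _ _ (fun a => a *: v)) => // a b _ _.
move=> /eqP; rewrite -subr_eq0 -scalerBl scaler_eq0 (negPf v0) orbF subr_eq0.
by move/eqP.
Qed.

Lemma card_le_rowvec (F : fieldType) n :
  infinite_set [set: F] -> [set: 'rV[F]_n] #<= [set: F].
Proof.
move=> infF; elim: n => [|n IHn].
  apply: (@card_le_inj _ _ _ _ (fun=> 0)) => // x y _ _ _.
  by apply/rowP; case.
apply: card_le_trans (card_le_square infF).
have [h _ hinj] := card_le_injE 0 IHn.
apply: (@card_le_inj _ _ _ _
  (fun u : 'rV_n.+1 => (u 0 0, h (\row_j u 0 (lift 0 j))))) => // u v _ _.
case=> e0 /(hinj _ _ Logic.I Logic.I)/rowP eu; apply/rowP => i.
by have [j ->|->] := unliftP 0 i; first by have := eu j; rewrite !mxE.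
Qed.

Lemma card_finite_dim (F : fieldType) (V : lmodType F) :
  infinite_set [set: F] -> finite_dim V -> [set: V] #<= [set: F].
Proof.
move=> infF [n [g [g' gK g'K]]].
apply: card_le_trans (card_le_rowvec n infF).
by apply: (@card_le_inj _ _ _ _ g') => // x y _ _ e; rewrite -[x]g'K e.
Qed.

Lemma card_le_option_rowvec (F : fieldType) n : infinite_set [set: F] ->
  [set: option 'rV[F]_n] #<= [set: F].
Proof.
move=> infF; apply: card_le_trans (card_le_square infF).
have [h _ hinj] := card_le_injE 0 (card_le_rowvec n infF).
apply: (@card_le_inj _ _ _ _
  (fun o => if o is Some u then (1, h u) else (0, 0))) => // -[u|] [v|] _ _ //.
- by case=> /hinj ->.
- by case=> /eqP; rewrite oner_eq0.
- by case=> /esym/eqP; rewrite oner_eq0.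
Qed.

Section LinearCombination.
Context (F : fieldType) (V : lmodType F) (n : nat) (x : 'I_n -> V).

Definition lincomb (u : 'rV[F]_n) : V := \sum_i u 0 i *: x i.

Lemma lincomb_is_linear : linear lincomb.
Proof.
move=> a u v; rewrite /lincomb scaler_sumr -big_split /=.
by apply: eq_bigr => i _; rewrite !mxE scalerDl scalerA.
Qed.

HB.instance Definition _ :=
  GRing.isLinear.Build F 'rV[F]_n V _ lincomb lincomb_is_linear.

End LinearCombination.

(** A spanning family of least size is a basis: a linear relation with nonzero
    coefficient at k allows the k-th vector to be dropped. *)
Lemma finite_dim_span (F : fieldType) (V : lmodType F) (K : finType) (y : K -> V) :
  (forall v, exists c : K -> F, v = \sum_k c k *: y k) -> finite_dim V.
Proof.
move=> ygen.
pose spans n := `[< exists x : 'I_n -> V, forall v, exists u, lincomb x u = v >].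
have : exists n, spans n.
  exists #|K|; apply/asboolP; exists (y \o enum_val) => v; have [c ->] := ygen v.
  exists (\row_i c (enum_val i)).
  rewrite [RHS](reindex _ (onW_bij _ (@enum_val_bij K))) /=.
  by apply: eq_bigr => i _; rewrite mxE.
case/ex_minnP => n /asboolP[x /choice[g gK]] min; exists n, (lincomb x).
suff linj : injective (lincomb x) by exists g => // u; apply: linj; rewrite gK.
apply: raddf_inj => w w0; apply/eqP; apply: contraT => /matrix0Pn[i [k]].
rewrite ord1 {i} => wk.
case: n => [|n] in x g gK min w w0 k wk *; first by case: k wk.
suff /min : spans n by rewrite ltnn.
apply/asboolP; exists (x \o lift k) => v.
pose u := g v - (g v 0 k / w 0 k) *: w.
exists (\row_j u 0 (lift k j)).
have <- : lincomb x u = v by rewrite /u linearB linearZ /= w0 scaler0 subr0.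
rewrite /lincomb (bigD1_ord k) //= !mxE divfK// subrr scale0r add0r.
by apply: eq_bigr => j _; rewrite !mxE.
Qed.

Section RestrictScalars.
Context (F : fieldType) (A : falgType F) (M : lmodType A).

Lemma restr_scalarsE (c : F) (a : A) (v : M) :
  c *: (a *: v : restr_scalars M) = ((c *: a) *: v : M).
Proof. by rewrite [LHS]scalerA -scalerAl mul1r. Qed.

(** The products of a basis of A with the generators span over F. *)
Lemma finite_dim_restr (s : seq M) :
  (forall v, exists c : M -> A, v = \sum_(y <- s) c y *: y) ->
  finite_dim (restr_scalars M).
Proof.
move=> sgen; pose e := vbasis {:A}.
apply: (@finite_dim_span F (restr_scalars M) ('I_(size s) * 'I_(\dim {:A}))%type
   (fun p => (e`_p.2 *: s`_p.1 : M))) => v.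
have [c ->] := sgen v.
exists (fun p : 'I_(size s) * 'I_(\dim {:A}) => coord e p.2 (c s`_p.1)).
rewrite (big_nth 0) big_mkord.
rewrite -(pair_big xpredT xpredT (fun (i : 'I_(size s)) (j : 'I_(\dim {:A})) =>
  coord e j (c s`_i) *: (e`_j *: s`_i : restr_scalars M))) /=.
apply: eq_bigr => i _.
rewrite {1}(coord_vbasis (memvf (c s`_i))) scaler_suml.
apply: eq_bigr => j _; exact/esym/restr_scalarsE.
Qed.

End RestrictScalars.

(** * Infinite direct sums of cyclic modules *)

Lemma sum_collect (A : pzRingType) (M : lmodType A) (T : eqType) (y : T -> M)
    (s : seq T) n (i : 'I_n -> T) (a : 'I_n -> A) :
  uniq s -> (forall k, i k \in s) ->
  \sum_k a k *: y (i k) = \sum_(j <- s) (\sum_(k | i k == j) a k) *: y j.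
Proof.
move=> s_uniq is_; under [RHS]eq_bigr do rewrite scaler_suml.
rewrite (exchange_big_dep xpredT) //=; apply: eq_bigr => k _.
rewrite big_mkcond (bigD1_seq (i k)) //= eqxx big1 ?addr0 // => j.
by rewrite eq_sym => /negPf ->.
Qed.

Section DirectSum.
Context (A : pzRingType) (M : lmodType A) (I : eqType) (m : I -> M).
Hypothesis hM : direct_sum_cyclic m.

Lemma direct_sum_indep (s : seq I) (b : I -> A) : uniq s ->
  \sum_(i <- s) b i *: m i = 0 -> forall i, i \in s -> b i *: m i = 0.
Proof.
move=> s_uniq; rewrite big_tnth => sum0 i /(tnthP (in_tuple s))[k ->].
apply: (hM.2 _ (tnth (in_tuple s)) (fun k => b (tnth (in_tuple s) k)) _ sum0).
exact/tuple_uniqP.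
Qed.

(** The family i may repeat indices; collecting the equal ones turns the relation
    into one between distinct indices, to which independence applies. *)
Lemma direct_sum_notin n (i : 'I_n -> I) (a : 'I_n -> A) (i0 : I) :
  (forall k, i k != i0) -> m i0 = \sum_k a k *: m (i k) -> m i0 = 0.
Proof.
move=> ii0 mE; pose s := undup (codom i).
have s_uniq : uniq s by exact: undup_uniq.
have is_ k : i k \in s by rewrite mem_undup codom_f.
have i0s : i0 \notin s.
  by rewrite mem_undup; apply/codomP => -[k e]; case/eqP: (ii0 k).
pose c j := if j == i0 then -1 else \sum_(k | i k == j) a k.
suff c0 : \sum_(j <- i0 :: s) c j *: m j = 0.
  have /= := direct_sum_indep (s := i0 :: s) _ c0 (mem_head _ _).
  by rewrite i0s s_uniq /c eqxx scaleN1r => /(_ isT)/eqP; rewrite oppr_eq0 => /eqP.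
rewrite big_cons {1}/c eqxx scaleN1r {1}mE (sum_collect _ _ s_uniq is_) addrC.
apply/eqP; rewrite subr_eq0; apply/eqP; apply: eq_big_seq => j js.
by rewrite /c; case: eqP js i0s => // -> ->.
Qed.

Section Chain.
Variable idx : nat -> I.
Hypotheses (idx_inj : injective idx) (idx_neq0 : forall p, m (idx p) <> 0).

(** The submodule spanned by the m_i whose index lies outside the tail
    idx p, idx (p + 1), ... of the chosen sequence of indices. *)
Definition chain_step (p : nat) : set M :=
  [set x | exists (n : nat) (i : 'I_n -> I) (a : 'I_n -> A),
    (forall k q, (p <= q)%N -> i k != idx q) /\ x = \sum_k a k *: m (i k)].

Lemma chain_step_submodule p : submodule (chain_step p).
Proof.
split.
  apply: mem_set; exists 0%N, (fun=> idx 0), (fun=> 0).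
  by split=> [[]//|]; rewrite big_ord0.
move=> c x y /set_mem[n1 [i1 [a1 [i1P ->]]]] /set_mem[n2 [i2 [a2 [i2P ->]]]].
apply: mem_set.
exists (n1 + n2)%N, (fun k => match fintype.split k with inl u => i1 u | inr u => i2 u end).
exists (fun k => match fintype.split k with inl u => c * a1 u | inr u => a2 u end).
split=> [k q pq|]; first by case: (fintype.split k) => u; [exact: i1P|exact: i2P].
rewrite big_split_ord /= scaler_sumr; congr (_ + _); apply: eq_bigr => u _.
  by rewrite -[lshift _ _]/(unsplit (inl u)) unsplitK scalerA.
by rewrite -[rshift _ _]/(unsplit (inr u)) unsplitK.
Qed.

Lemma chain_step_proper p : proper_submodule (chain_step p).
Proof.
split=> [|NT]; first exact: chain_step_submodule.
have : [set: M] (m (idx p)) by [].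
rewrite -NT => -[n [i [a [iP mE]]]].
by apply: (@idx_neq0 p); apply: direct_sum_notin mE => k; exact: iP.
Qed.

Lemma chain_step_cover : \bigcup_(p in [set: nat]) chain_step p = [set: M].
Proof.
apply/seteqP; split=> // x _; have [n [i [a ->]]] := hM.1 x.
have boundP k : exists r, forall q, (r <= q)%N -> i k != idx q.
  have [[q0 e]|ne] := pselect (exists q, i k = idx q).
    exists q0.+1 => q; apply: contraTneq; rewrite e => /idx_inj ->.
    by rewrite ltnn.
  by exists 0%N => q _; apply/eqP => e; apply: ne; exists q.
have [r rP] := choice boundP.
exists (\max_k r k) => //; exists n, i, a; split=> // k q le_q.
by apply: rP; apply: leq_trans le_q; exact: leq_bigmax.
Qed.

End Chain.
End DirectSum.

(** Finitely many values of m would span M over A, hence, with A of finite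
    dimension, span a space of finite dimension over F. *)
Lemma infinite_dim_range (F : fieldType) (A : falgType F) (M : lmodType A)
    (I : Type) (m : I -> M) :
  direct_sum_cyclic m -> ~ finite_dim (restr_scalars M) -> infinite_set (range m).
Proof.
move=> [gen _] + finm; apply.
have [s sE] : exists s : seq M, range m = [set` s] by exact/finite_seqP.
apply: (@finite_dim_restr F A M (undup s)) => v.
have [n [i [a ->]]] := gen v.
exists (fun y => \sum_(k | m (i k) == y) a k).
apply: (@sum_collect A M M id) => [|k]; first exact: undup_uniq.
have : range m (m (i k)) by exists (i k).
by rewrite sE mem_undup.
Qed.

Lemma infinite_dim_cover (F : fieldType) (A : falgType F) (M : lmodType A)
    (I : Type) (m : I -> M) :
  direct_sum_cyclic m -> ~ finite_dim (restr_scalars M) ->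
  exists N : nat -> set M, (forall p, proper_submodule (N p)) /\
    \bigcup_(p in [set: nat]) N p = [set: M].
Proof.
move=> hM /(infinite_dim_range hM) infm.
have : infinite_set (range m `\` [set 0]).
  by apply: infinite_setD => //; exact: finite_set1.
move=> /infiniteP/(card_le_injE 0)[v vm vinj].
have idxP p : exists i : {classic I}, m i = v p.
  by have [[i _ <-] _] := vm p Logic.I; exists i.
have [idx idxE] := choice idxP.
have idx_inj : injective idx.
  by move=> p q e; apply: vinj => //; rewrite -!idxE e.
have idx_neq0 p : m (idx p) <> 0 by rewrite idxE; case: (vm p Logic.I).
exists (chain_step (I := {classic I}) m idx); split=> [p|].
  exact: (@chain_step_proper A M {classic I} m hM idx idx_neq0 p).
exact: (@chain_step_cover A M {classic I} m hM idx idx_inj).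
Qed.

(** * The number of proper submodules in a cover *)

Theorem proposition1p5 (F : fieldType) (hF : infinite_set [set: F])
    (A : falgType F) (M : lmodType A)
    (I : Type) (m : I -> M) (hM : direct_sum_cyclic m) (J : Type) :
  (exists N : J -> set M,
      (forall j, proper_submodule (N j)) /\
      \bigcup_(j in [set: J]) N j = [set: M]) <->
  (~ cyclic_module M /\ [set: J] #>= [set: nu (restr_scalars M) 1]).
Proof.
split=> [[N [Nproper NM]]|[Mncyc leJ]].
- have Nfull j := proper_submodule_missing (Nproper j).
  split.
    (* The member that contains a generator g contains everything. *)
    case=> g gM; have : [set: M] g by [].
    rewrite -NM => -[j _ Njg]; have [x] := Nfull j; apply; have [a ->] := gM x.
    exact: submodule_scale (Nproper j).1 Njg.
  have NresP j : @proper_submodule F (restr_scalars M) (N j).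
    by split; [exact/submodule_restr/(Nproper j).1|case: (Nproper j)].
  have infM : infinite_set [set: restr_scalars M].
    have [v v0] : exists v : M, v != 0.
      have : [set: M] 0 by [].
      rewrite -NM => -[j _ Nj0]; have [x nx] := Nfull j.
      by exists x; apply: contra_not_neq nx => ->.
    exact: (@infinite_lmodule F (restr_scalars M) v hF v0).
  (* As M is infinite, nu is nat or F with a point at infinity, according to
     the dimension. *)
  rewrite /nu; case: pselect => [//|/= _]; case: pselect => [/= _|/= fdim].
    by apply/infiniteP; exact: cover_infinite hF NresP NM.
  have dimM : finite_dim (restr_scalars M) by apply: contrapT => ?; exact: fdim.
  apply: card_le_trans (cover_finite_dim hF dimM NresP NM).
  exact: card_le_option_rowvec.
- have infM : infinite_set [set: restr_scalars M].
    have [v v0] : exists v : M, v != 0.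
      apply: contrapT => M0; apply: Mncyc; exists 0 => x; exists 0.
      rewrite scaler0; apply/eqP; apply: contrapT => /negP x0; apply: M0.
      by exists x.
    exact: (@infinite_lmodule F (restr_scalars M) v hF v0).
  move: leJ; rewrite /nu; case: pselect => [//|/= _].
  case: pselect => [[_ ndim]|fdim] /= leJ.
    have [N [Nproper NM]] := infinite_dim_cover hM ndim.
    by apply: (card_le_cover 0%N leJ Nproper); rewrite NM.
  have dimM : finite_dim (restr_scalars M) by apply: contrapT => ?; exact: fdim.
  apply: (@card_le_cover M M J _ (fun x => [set a *: x | a in [set: A]]) 0).
  - apply: card_le_trans leJ.
    apply: card_le_trans (card_finite_dim hF dimM) _.
    apply: (@card_le_inj _ _ _ _ (fun a => Some (const_mx a))) => // a b _ _.
    by case=> /matrixP/(_ 0 0); rewrite !mxE.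
  - by move=> x; split; [exact: cyclic_submodule|
      move=> xM; apply: Mncyc; exists x => y;
      have : [set: M] y by []; rewrite -xM => -[a _ <-]; exists a].
  - apply/seteqP; split=> // x _; exists x => //; exists 1 => //; exact: scale1r.
Qed.
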